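(* Let $\theta\in[0,2\pi)$, let $H=\frac1{\sqrt2}\begin{pmatrix}1&1\\1&-1\end{pmatrix}$, $R_Y(\theta)=e^{-i\frac\theta2Y}$ and $R_X(\theta)=e^{-i\frac\theta2X}$ be single-qubit gates, and let $\xi$ denote the unitary extent. Then $$\xi(H)=2,\qquad \xi(R_Y(\theta))=\xi(R_X(\theta))=1+|\sin\theta|,$$ and the following decompositions are optimal with respect to the unitary extent: $$H=\frac{1}{\sqrt2}(X+Z),\qquad R_Y(\theta)=\cos\left(\tfrac\theta2\right)I-i\sin\left(\tfrac\theta2\right)Y,\qquad R_X(\theta)=\cos\left(\tfrac\theta2\right)I-i\sin\left(\tfrac\theta2\right)X .$$
   Context: On $n$ qubits let $c_{2j-1}=Z^{\otimes(j-1)}\otimes X\otimes I^{\otimes(n-j)}$ and $c_{2j}=Z^{\otimes(j-1)}\otimes Y\otimes I^{\otimes(n-j)}$, $j=1,\dots,n$ (so $c_1=X$, $c_2=Y$ for $n=1$). The set $G_n$ of Gaussian unitaries consists of the $n$-qubit unitaries $V$ for which there is $R\in O(2n)$ with $Vc_jV^\dagger=\sum_kR_{j,k}c_k$ for all $j$. The unitary extent of an $n$-qubit unitary $U$ is $\xi(U)=\min\{\|c\|_1^2: U=\sum_{j=1}^{\chi}c_jK_j,\ \chi\in\mathbb{N},\ K_j\in G_n,\ c_j\in\mathbb{C}\}$, where $\|c\|_1=\sum_j|c_j|$. A decomposition $U=\sum_jc_jK_j$ with $K_j\in G_n$ is optimal if $\xi(U)=\|c\|_1^2$. *)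

(* Defs.v *)
From HB Require Import structures.
From mathcomp Require Import all_boot all_order all_algebra spectral.
From mathcomp Require Import all_classical all_reals all_analysis.
From mathcomp Require Import complex mxtens.
Set Implicit Arguments.
Unset Strict Implicit.
Unset Printing Implicit Defensive.
Import Order.TTheory GRing.Theory Num.Theory.
Import numFieldNormedType.Exports.
Local Open Scope classical_set_scope.
Local Open Scope ring_scope.
Local Open Scope complex_scope.

Definition mx2 (C : pzRingType) (a b c d : C) : 'M[C]_2 :=
  \matrix_(i, j) if i == ord0 then if j == ord0 then a else b
                 else if j == ord0 then c else d.

Definition pauliX (R : realType) : 'M[R[i]]_2 := mx2 0 1 1 0.
Definition pauliY (R : realType) : 'M[R[i]]_2 := mx2 0 (- 'i%C) 'i%C 0.
Definition pauliZ (R : realType) : 'M[R[i]]_2 := mx2 1 0 0 (- 1).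

Definition hadamard (R : realType) : 'M[R[i]]_2 :=
  ((Num.sqrt 2)^-1)%:C *: mx2 1 1 1 (- 1).

(* The limit is taken in the library's (entrywise) topology on matrices. *)
Definition expmx (C : numFieldType) (n : nat) (A : 'M[C]_n.+1) : 'M[C]_n.+1 :=
  limn (series (fun k => k`!%:R^-1 *: A ^+ k)).

Definition rotX (R : realType) (theta : R) : 'M[R[i]]_2 :=
  expmx (- 'i%C * (theta / 2)%:C *: pauliX R).
Definition rotY (R : realType) (theta : R) : 'M[R[i]]_2 :=
  expmx (- 'i%C * (theta / 2)%:C *: pauliY R).

Lemma majorana_dim (n : nat) (k : 'I_(2 * n)) :
  (2 ^ k./2 * 2 * 2 ^ (n - k./2.+1) = 2 ^ n)%N.
Proof.
have lt_kn : (k./2 < n)%N by rewrite ltn_half_double -mul2n.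
by rewrite -expnSr -expnD subnKC.
Qed.

(* Indices start at 0: [majorana k] is c_(k+1), so that even [k = 2 (j - 1)]
   gives c_(2j-1), odd [k = 2 j - 1] gives c_(2j), and [k./2 = j - 1].
   [A *t B] is the Kronecker product and [A ^t m] the m-fold tensor power. *)
Definition majorana (R : realType) (n : nat) (k : 'I_(2 * n)) :
    'M[R[i]]_(2 ^ n) :=
  castmx (majorana_dim k, majorana_dim k)
    ((pauliZ R ^t k./2)
       *t (if odd k then pauliY R else pauliX R)
       *t ((1%:M : 'M[R[i]]_2) ^t (n - k./2.+1))).
Arguments majorana : clear implicits.
Arguments majorana R {n} k.

(* The set G_n; the matrix [Q] below ranges over O(2n). *)
Definition gaussian_unitary (R : realType) (n : nat) (V : 'M[R[i]]_(2 ^ n)) :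
    Prop :=
  V \is unitarymx /\
  exists2 Q : 'M[R]_(2 * n), Q *m Q^T = 1%:M &
    forall j : 'I_(2 * n),
      V *m majorana R j *m (V^t*)%sesqui
      = \sum_k (Q j k)%:C *: majorana R k.

(* A finite sequence [:: (c_1, K_1); ...; (c_chi, K_chi)] stands for the linear
   combination sum_j c_j K_j. *)
Definition gaussian_decomposition (R : realType) (n : nat)
    (U : 'M[R[i]]_(2 ^ n)) (s : seq (R[i] * 'M[R[i]]_(2 ^ n))) : Prop :=
  (forall p, p \in s -> gaussian_unitary p.2) /\
  U = \sum_(p <- s) p.1 *: p.2.

(* [Normc.normc z] is the modulus of [z] as an element of [R]; the norm [`|z|] of
   [R[i]] takes its values in [R[i]]. *)
Definition coef_norm1 (R : realType) (n : nat)
    (s : seq (R[i] * 'M[R[i]]_(2 ^ n))) : R :=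
  \sum_(p <- s) Normc.normc p.1.

Definition decomposition_costs (R : realType) (n : nat)
    (U : 'M[R[i]]_(2 ^ n)) : set R :=
  [set coef_norm1 s ^+ 2 | s in gaussian_decomposition U].

(* The minimum of the costs; the value 0 is used when there is no minimum. *)
Definition unitary_extent (R : realType) (n : nat) (U : 'M[R[i]]_(2 ^ n)) : R :=
  xget 0 [set m | decomposition_costs U m /\ lbound (decomposition_costs U) m].

Definition optimal_decomposition (R : realType) (n : nat)
    (U : 'M[R[i]]_(2 ^ n)) (s : seq (R[i] * 'M[R[i]]_(2 ^ n))) : Prop :=
  gaussian_decomposition U s /\ unitary_extent U = coef_norm1 s ^+ 2.

Arguments unitary_extent R n U : clear implicits.
Arguments unitary_extent {R} n U.
Arguments optimal_decomposition {R} n U s.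

(* Main.v *)
(** A one-qubit Gaussian unitary conjugates X and Y into the span of X and Y, so
    both images have a zero diagonal; this forces the unitary to be diagonal or
    antidiagonal, and the l1 norm of its first row is then 1.  By the triangle
    inequality, the l1 norm of the first row of U is a lower bound for the l1 norm
    of the coefficients of any Gaussian decomposition of U, and the three given
    decompositions attain this bound. *)

Require Import Defs.
From mathcomp Require Import all_boot all_order all_algebra spectral.
From mathcomp Require Import all_classical all_reals all_analysis.
From mathcomp Require Import complex ring.
Set Implicit Arguments.
Unset Strict Implicit.
Unset Printing Implicit Defensive.
Import Order.TTheory GRing.Theory Num.Theory.
Import numFieldNormedType.Exports.
Local Open Scope ring_scope.
Local Open Scope complex_scope.

(** * Exponential of an involution *)

Lemma norm_complexE (R : realType) (z : R[i]) : `|z| = (Normc.normc z)%:C.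
Proof. by []. Qed.

Lemma cvg_real_complex (R : realType) (u : nat -> R) (l : R) :
  (u @ \oo --> l)%classic -> ((fun n => (u n)%:C : (R[i] : numFieldType)) @ \oo -->
    (l%:C : (R[i] : numFieldType)))%classic.
Proof.
move=> ul; apply/cvgrPdist_lt => e e0.
(* The norm of [R[i]] is [R[i]]-valued, so [e] is a complex number; its positivity makes it real. *)
have /complex_realP[r er] : e \is Num.real by exact: gtr0_real.
rewrite er (ltcR 0) in e0.
near=> n; rewrite er -rmorphB /= normc_def /= expr0n /= addr0 sqrtr_sqr ltcR.
by near: n; exact: (@cvgr_dist_lt _ _ _ _ _ u l).
Unshelve. all: by end_near. Qed.

(** Even powers of [P] are the identity and odd powers are [P], so the exponential series splits
    into the cosine series along [1%:M] and the sine series along [P]. *)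
Lemma expmx_involution (R : realType) (n : nat) (P : 'M[R[i]]_n.+1) (t : R) :
  P *m P = 1%:M ->
  expmx (- 'i%C * t%:C *: P)
  = (cos t)%:C *: 1%:M + (- 'i%C * (sin t)%:C) *: P.
Proof.
move=> PP; rewrite /expmx.
have P2 : P ^+ 2 = 1 by rewrite expr2; exact: PP.
have termE k : k`!%:R^-1 *: (- 'i%C * t%:C *: P) ^+ k =
    (cos_coeff t k)%:C *: 1%:M + (- 'i%C * (sin_coeff t k)%:C) *: P.
  rewrite /cos_coeff /sin_coeff /= exprZn.
  have fE : (k`!%:R : R[i])^-1 = (k`!%:R^-1)%:C.
    by rewrite (rmorphV (real_complex R)) ?rmorph_nat // unitfE pnatr_eq0 -lt0n fact_gt0.
  have i2 : (- 'i%C) ^+ 2 = -1 :> R[i] by rewrite sqrrN sqr_i.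
  have kE := odd_double_half k; set h := k./2 in kE *.
  have Pk : P ^+ k = P ^+ odd k by rewrite -[in LHS]kE exprD -mul2n exprM P2 expr1n mulr1.
  have ik : (- 'i%C) ^+ k = (- 'i%C) ^+ odd k * ((-1) ^+ h)%:C :> R[i].
    rewrite -[in LHS]kE exprD -mul2n exprM i2.
    by rewrite rmorphXn rmorphN1.
  rewrite Pk exprMn ik fE -rmorphXn /= scalerA.
  case: (odd k) kE => kE.
    (* The sign in [sin_coeff] has exponent [k.-1./2]; for odd [k] this is the [h] coming from the
       power of [- 'i%C]. *)
    have -> : k.-1./2 = h by rewrite -kE /= doubleK.
    rewrite !expr1 !mul0r scale0r add0r !mul1r; congr (_ *: _).
    rewrite !rmorphM /=; ring.
  rewrite !expr0 !mul0r mulr0 scale0r addr0 !mul1r; congr (_ *: _).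
  rewrite !rmorphM /=; ring.
have -> : series (fun k => k`!%:R^-1 *: (- 'i%C * t%:C *: P) ^+ k) =
   (fun m => (series (cos_coeff t) m)%:C *: (1%:M : 'M[R[i]]_n.+1)
          + (- 'i%C * (series (sin_coeff t) m)%:C) *: P).
  apply/funext => m; rewrite /series /= (eq_bigr _ (fun i _ => termE i)).
  by rewrite big_split /= -!scaler_suml -mulr_sumr !rmorph_sum.
apply: cvg_lim; first exact: norm_hausdorff.
apply: cvgD; apply: cvgZr_tmp; last apply: cvgM; first 2 last.
- apply: cvg_real_complex; rewrite sin.unlock; exact: is_cvg_series_sin_coeff.
- apply: cvg_real_complex; rewrite cos.unlock; exact: is_cvg_series_cos_coeff.
- exact: cvg_cst.
Qed.

(** * Two-by-two matrices and the one-qubit Majorana operators *)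

Lemma mx2_eta (C : pzRingType) (A : 'M[C]_2) : A = mx2 (A 0 0) (A 0 1) (A 1 0) (A 1 1).
Proof.
apply/matrixP => i j; rewrite mxE.
by case: i => [[|[|]]] // ?; case: j => [[|[|]]] // ? /=;
  congr (A _ _); apply: val_inj.
Qed.

Lemma mx2_eq (C : pzRingType) (a b c d a' b' c' d' : C) :
  mx2 a b c d = mx2 a' b' c' d' <-> [/\ a = a', b = b', c = c' & d = d'].
Proof.
split=> [/matrixP e|[-> -> -> ->]//].
by split; [move: (e 0 0)|move: (e 0 1)|move: (e 1 0)|move: (e 1 1)]; rewrite !mxE.
Qed.

Lemma mx2_mul (C : pzRingType) (a b c d a' b' c' d' : C) :
  mx2 a b c d *m mx2 a' b' c' d' =
  mx2 (a * a' + b * c') (a * b' + b * d') (c * a' + d * c') (c * b' + d * d').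
Proof.
rewrite [LHS]mx2_eta; apply/mx2_eq; split;
  by rewrite !mxE !big_ord_recl big_ord0 !mxE addr0.
Qed.

Lemma mx2_add (C : pzRingType) (a b c d a' b' c' d' : C) :
  mx2 a b c d + mx2 a' b' c' d' = mx2 (a + a') (b + b') (c + c') (d + d').
Proof. by rewrite [LHS]mx2_eta; apply/mx2_eq; split; rewrite !mxE. Qed.

Lemma mx2_scale (C : pzRingType) (k a b c d : C) :
  k *: mx2 a b c d = mx2 (k * a) (k * b) (k * c) (k * d).
Proof. by rewrite [LHS]mx2_eta; apply/mx2_eq; split; rewrite !mxE. Qed.

Lemma mx2_1 (C : pzRingType) : 1%:M = mx2 1 0 0 1 :> 'M[C]_2.
Proof. by rewrite [LHS]mx2_eta; apply/mx2_eq; split; rewrite !mxE. Qed.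

Lemma mx2_adj (R : realType) (a b c d : R[i]) :
  ((mx2 a b c d)^t*)%sesqui = mx2 a^*%C c^*%C b^*%C d^*%C.
Proof. by rewrite [LHS]mx2_eta; apply/mx2_eq; split; rewrite !mxE. Qed.

(** For one qubit [k./2] and [n - k./2.+1] are both 0, so the outer tensor powers are trivial and
    only the middle factor survives. *)
Lemma majorana1E (R : realType) (k : 'I_(2 * 1)) :
  majorana R k = (if odd k then pauliY R else pauliX R) :> 'M[R[i]]_2.
Proof.
case: k => [[|[|]]] //= lt_k2; rewrite /majorana /= [LHS]mx2_eta.
- by apply/mx2_eq; split; rewrite !castmxE !mxE /= ?(mul0r, mulr0, mul1r, mulr1).
- by apply/mx2_eq; split; rewrite !castmxE !mxE /= ?(mul0r, mulr0, mul1r, mulr1).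
Qed.

Lemma normc_ge0 (R : realType) (z : R[i]) : 0 <= Normc.normc z.
Proof. by case: z => a b; exact: sqrtr_ge0. Qed.

Lemma normc_real (R : realType) (x : R) : Normc.normc x%:C = `|x|.
Proof. by rewrite /= expr0n /= addr0 sqrtr_sqr. Qed.

Lemma normc_NiM (R : realType) (x : R) : Normc.normc (- 'i%C * x%:C) = `|x|.
Proof. by rewrite Normc.normcM normcN normc_real /= expr0n expr1n add0r sqrtr1 mul1r. Qed.

(** * Gaussianity of the Pauli matrices *)

Lemma sum_I2 (V : nmodType) (F : 'I_(2 * 1) -> V) :
  \sum_k F k = F ord0 + F ord_max.
Proof.
by rewrite (big_ord_recl 1) (big_ord_recl 0) big_ord0 addr0;
  congr (_ + F _); apply: val_inj.
Qed.

Lemma gaussian_of_signs (R : realType) (P : 'M[R[i]]_2) (s0 s1 : R) :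
  s0 ^+ 2 = 1 -> s1 ^+ 2 = 1 -> P *m (P^t*)%sesqui = 1%:M ->
  P *m pauliX R *m (P^t*)%sesqui = s0%:C *: pauliX R ->
  P *m pauliY R *m (P^t*)%sesqui = s1%:C *: pauliY R ->
  @gaussian_unitary R 1 P.
Proof.
move=> s02 s12 uP PX PY; split; first exact/unitarymxP.
(* The witness is the diagonal matrix with entries [s0] and [s1], orthogonal because both squares
   are 1. *)
pose Q : 'M[R]_(2 * 1) := \matrix_(j, k) ((j == k)%:R * if odd k then s1 else s0).
exists Q.
  by apply/matrixP => -[[|[|]]] // ? -[[|[|]]] // ?; rewrite !mxE sum_I2 !mxE /=
    ?(mul0r, mulr0, mul1r, addr0, add0r) -?expr2.
move=> j; rewrite sum_I2 !majorana1E /= !mxE.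
case: j => [[|[|]]] // ?; rewrite /= ?(mul0r, mul1r) scale0r ?addr0 ?add0r.
- exact: PX.
- exact: PY.
Qed.

(** A Pauli matrix commutes with itself and anticommutes with the other two; this dictates the pair
    of signs passed to [gaussian_of_signs] in each case. *)
Lemma gaussian_paulis (R : realType) :
  [/\ @gaussian_unitary R 1 (1%:M : 'M[R[i]]_2), @gaussian_unitary R 1 (pauliX R),
    @gaussian_unitary R 1 (pauliY R) & @gaussian_unitary R 1 (pauliZ R)].
Proof.
have i2 : 'i%C * 'i%C = -1 :> R[i] by rewrite -expr2 sqr_i.
have iJ : 'i%C^*%C = - 'i%C :> R[i] by apply/eqP; rewrite eq_complex /= !oppr0 !eqxx.
have conjcN (x : R[i]) : (- x)^*%C = - x^*%C by rewrite rmorphN.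
have pauliE := (i2, iJ, conjc1, conjc0, conjcN, rmorphN1, rmorph1, mulN1r, mulrN1, mulrN,
  mulNr, mul0r, mulr0, mul1r, mulr1, addr0, add0r, @opprK R[i], oppr0).
split; [apply: (@gaussian_of_signs R _ 1 1) | apply: (@gaussian_of_signs R _ 1 (-1))
  | apply: (@gaussian_of_signs R _ (-1) 1) | apply: (@gaussian_of_signs R _ (-1) (-1))];
  rewrite ?sqrrN ?expr1n // ?mx2_1 /pauliX /pauliY ?/pauliZ mx2_adj !mx2_mul ?mx2_scale;
  by apply/mx2_eq; split; rewrite !pauliE.
Qed.

(** * Lower bound from the first row *)

Definition row0_norm1 (R : realType) (U : 'M[R[i]]_2) : R :=
  Normc.normc (U 0 0) + Normc.normc (U 0 1).

Lemma gaussian_row0_norm1 (R : realType) (V : 'M[R[i]]_2) :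
  @gaussian_unitary R 1 V -> row0_norm1 V = 1.
Proof.
move=> [/unitarymxP uV [Q _ VQ]]; rewrite /row0_norm1.
have {}VQ (j : 'I_(2 * 1)) : V *m (majorana R j : 'M[R[i]]_2) *m (V^t*)%sesqui =
    (Q j ord0)%:C *: pauliX R + (Q j ord_max)%:C *: pauliY R.
  by rewrite VQ sum_I2 !majorana1E.
have VX := VQ ord0; have VY := VQ ord_max.
rewrite !majorana1E /= in VX VY.
rewrite (mx2_eta V) /pauliX /pauliY ?mx2_1 mx2_adj !mx2_mul !mx2_scale !mx2_add
  in uV VX VY.
set a := V 0 0 in uV VX VY *; set b := V 0 1 in uV VX VY *.
case/mx2_eq: uV => uV _ _ _; case/mx2_eq: VX => VX _ _ _; case/mx2_eq: VY => VY _ _ _.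
have i0 : 'i%C != 0 :> R[i] by rewrite eq_complex /= oner_eq0 andbF.
(* the (0,0) entries of V X V^dagger and V Y V^dagger are 2 Re (a b^* ) and
   2 Im (a b^* ) up to sign *)
have ab : a * b^*%C = 0.
  have VX' : a * b^*%C + b * a^*%C = 0.
    by move: VX; rewrite !mulr0 !addr0 add0r !mulr1 addrC.
  have VY' : a * b^*%C - b * a^*%C = 0.
    apply: (mulfI (x := - 'i%C)); rewrite ?oppr_eq0 // mulr0.
    by move: VY; rewrite !mulr0 !addr0 add0r => <-; ring.
  have : (a * b^*%C) *+ 2 = 0.
    by rewrite mulr2n -[X in X + _](addrK (b * a^*%C)) VX' add0r addrC.
  by move/eqP; rewrite mulrn_eq0 /= => /eqP.
(* The first row of a unitary is a unit vector; as [a] or [b] vanishes, the other one has modulus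
   1. *)
have one : Normc.normc a ^+ 2 + Normc.normc b ^+ 2 = 1.
  apply: (@complexI R); rewrite rmorphD !rmorphXn /= -!norm_complexE.
  by rewrite !sqr_normc uV.
move/eqP: ab; rewrite mulf_eq0 conjc_eq0 => /orP[] /eqP z0; move: one;
  rewrite z0 Normc.normc0 expr0n /= ?(add0r, addr0) => /eqP;
  rewrite sqrp_eq1 ?normc_ge0 // => /eqP //.
Qed.

(** By induction on [s]: [row0_norm1] is subadditive and absolutely homogeneous, so each term
    contributes at most the modulus of its coefficient. *)
Lemma row0_norm1_le_coef_norm1 (R : realType) (U : 'M[R[i]]_2)
    (s : seq (R[i] * 'M[R[i]]_2)) :
  @gaussian_decomposition R 1 U s -> row0_norm1 U <= @coef_norm1 R 1 s.
Proof.
move=> [gs ->]; rewrite /coef_norm1.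
elim: s gs => [|p s IHs] gs.
  by rewrite !big_nil /row0_norm1 !mxE Normc.normc0 addr0.
rewrite !big_cons; apply: le_trans (_ : row0_norm1 (p.1 *: p.2) +
  row0_norm1 (\sum_(q <- s) q.1 *: q.2) <= _).
  rewrite /row0_norm1 addrACA !mxE; apply: lerD; exact: le_normcD.
apply: lerD; last by apply: IHs => q qs; apply: gs; rewrite inE qs orbT.
rewrite /row0_norm1 !mxE !Normc.normcM -mulrDr.
by rewrite -/(row0_norm1 p.2) gaussian_row0_norm1 ?mulr1 //; apply: gs; rewrite inE eqxx.
Qed.

(** Attaining the first-row bound certifies optimality, since squaring is monotone on nonnegative
    reals. *)
Lemma tight_decomposition_optimal (R : realType) (U : 'M[R[i]]_2)
    (s : seq (R[i] * 'M[R[i]]_2)) :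
  @gaussian_decomposition R 1 U s -> @coef_norm1 R 1 s = row0_norm1 U ->
  @optimal_decomposition R 1 U s.
Proof.
move=> Us costs; split=> //.
have row0_ge0 : 0 <= row0_norm1 U by rewrite addr_ge0 ?normc_ge0.
have sP : decomposition_costs (U : 'M[R[i]]_(2 ^ 1)) (@coef_norm1 R 1 s ^+ 2) /\
    lbound (decomposition_costs (U : 'M[R[i]]_(2 ^ 1))) (@coef_norm1 R 1 s ^+ 2).
  split; first by exists s.
  move=> _ [s' Us' <-]; rewrite costs lerXn2r ?nnegrE //.
    exact: le_trans row0_ge0 (row0_norm1_le_coef_norm1 Us').
  exact: row0_norm1_le_coef_norm1.
(* The default value 0 of [xget] is excluded because [sP] exhibits a minimum; two minima agree by
   antisymmetry. *)
rewrite /unitary_extent; case: xgetP => [m _ [mcost mlb]|/(_ _ sP) //].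
by apply/eqP; rewrite eq_le mlb ?(sP.2 _ mcost) //; exact: sP.1.
Qed.

(** * Optimal decompositions of the three gates *)

Lemma pauliX_sqr (R : realType) : pauliX R *m pauliX R = 1%:M.
Proof.
rewrite mx2_mul mx2_1.
by apply/mx2_eq; split; rewrite !(mul0r, mulr0, mul1r, addr0, add0r).
Qed.

Lemma pauliY_sqr (R : realType) : pauliY R *m pauliY R = 1%:M.
Proof.
rewrite mx2_mul mx2_1; apply/mx2_eq; split;
  by rewrite !(mul0r, mulr0, mulrN, mulNr, addr0, add0r) // -expr2 sqr_i opprK.
Qed.

(** The squares add up to 1, and the cross term is the modulus of [sin x] by the double-angle
    formula. *)
Lemma sqr_norm_cos_sin_half (R : realType) (x : R) :
  (`|cos (x / 2)| + `|sin (x / 2)|) ^+ 2 = 1 + `|sin x|.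
Proof.
rewrite sqrrD !real_normK ?num_real // addrAC cos2Dsin2 -normrM -normrMn.
have xE : x = (x / 2) *+ 2 by rewrite -mulr_natr divfK.
by rewrite {3}xE sin_mulr2n.
Qed.

(** In the first row the identity fills only the diagonal entry and [P] only the other one, with
    modulus 1; nothing cancels, so the bound is tight. *)
Lemma rotation_optimal (R : realType) (P : 'M[R[i]]_2) (t : R) :
  P *m P = 1%:M -> @gaussian_unitary R 1 P ->
  P 0 0 = 0 -> Normc.normc (P 0 1) = 1 ->
  @optimal_decomposition R 1 (expmx (- 'i%C * (t / 2)%:C *: P))
    [:: ((cos (t / 2))%:C, 1%:M); (- 'i%C * (sin (t / 2))%:C, P)].
Proof.
move=> PP gP P00 P01; have [gI _ _ _] := gaussian_paulis R.
rewrite expmx_involution //; apply: tight_decomposition_optimal.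
  split; last by rewrite !big_cons big_nil addr0.
  by move=> p; rewrite !inE => /orP[] /eqP ->.
rewrite /coef_norm1 /row0_norm1 !big_cons big_nil !addr0.
congr (Normc.normc _ + _); first by rewrite !mxE P00 mulr0 addr0 mulr1.
by rewrite !mxE mulr0 add0r [RHS]Normc.normcM P01 mulr1.
Qed.

Lemma rotation_cost (R : realType) (P : 'M[R[i]]_2) (t : R) :
  @coef_norm1 R 1 [:: ((cos (t / 2))%:C, 1%:M); (- 'i%C * (sin (t / 2))%:C, P)] ^+ 2
  = 1 + `|sin t|.
Proof.
rewrite /coef_norm1 !big_cons big_nil addr0 normc_NiM normc_real.
exact: sqr_norm_cos_sin_half.
Qed.

(** The same disjointness holds here: in the first row [pauliZ] fills the diagonal entry and
    [pauliX] the other. *)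
Lemma hadamard_optimal (R : realType) :
  @optimal_decomposition R 1 (hadamard R)
    [:: (((Num.sqrt 2)^-1)%:C, pauliX R); (((Num.sqrt 2)^-1)%:C, pauliZ R)].
Proof.
have [_ gX _ gZ] := gaussian_paulis R; apply: tight_decomposition_optimal.
  split; first by move=> p; rewrite !inE => /orP[] /eqP ->.
  rewrite !big_cons big_nil addr0 -scalerDr mx2_add.
  by congr (_ *: mx2 _ _ _ _); rewrite ?addr0 ?add0r.
rewrite /coef_norm1 !big_cons big_nil addr0 /row0_norm1 !mxE.
by rewrite !mulr1.
Qed.

Lemma hadamard_cost (R : realType) :
  @coef_norm1 R 1
    [:: (((Num.sqrt 2)^-1)%:C, pauliX R); (((Num.sqrt 2)^-1)%:C, pauliZ R)] ^+ 2
  = 2.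
Proof.
rewrite /coef_norm1 !big_cons big_nil addr0 normc_real.
rewrite ger0_norm ?invr_ge0 ?sqrtr_ge0 // -mulr2n exprMn_n exprVn.
by rewrite sqr_sqrtr ?ler0n // -[LHS]mulr_natr natrX expr2 mulKf ?pnatr_eq0.
Qed.

Theorem mainTheorem5 (R : realType) (theta : R)
    (theta_range : 0 <= theta < 2 * pi) :
  [/\ unitary_extent 1 (hadamard R) = 2,
      unitary_extent 1 (rotY theta) = 1 + `|sin theta| &
      unitary_extent 1 (rotX theta) = 1 + `|sin theta|] /\
  [/\ optimal_decomposition 1 (hadamard R)
        [:: (((Num.sqrt 2)^-1)%:C, pauliX R); (((Num.sqrt 2)^-1)%:C, pauliZ R)],
      optimal_decomposition 1 (rotY theta)
        [:: ((cos (theta / 2))%:C, 1%:M);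
            (- 'i%C * (sin (theta / 2))%:C, pauliY R)] &
      optimal_decomposition 1 (rotX theta)
        [:: ((cos (theta / 2))%:C, 1%:M);
            (- 'i%C * (sin (theta / 2))%:C, pauliX R)]].
Proof.
have [_ gX gY _] := gaussian_paulis R.
have optX : optimal_decomposition 1 (rotX theta)
    [:: ((cos (theta / 2))%:C, 1%:M); (- 'i%C * (sin (theta / 2))%:C, pauliX R)].
  apply: (rotation_optimal theta (pauliX_sqr R)) => //; rewrite !mxE //.
  exact: Normc.normc1.
have optY : optimal_decomposition 1 (rotY theta)
    [:: ((cos (theta / 2))%:C, 1%:M); (- 'i%C * (sin (theta / 2))%:C, pauliY R)].
  apply: (rotation_optimal theta (pauliY_sqr R)) => //; rewrite !mxE //.
  by rewrite normcN /= expr0n expr1n add0r sqrtr1.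
have optH := hadamard_optimal R.
split; split; [| | |exact: optH|exact: optY|exact: optX].
- by rewrite -hadamard_cost; exact: optH.2.
- by rewrite -(rotation_cost (pauliY R)); exact: optY.2.
- by rewrite -(rotation_cost (pauliX R)); exact: optX.2.
Qed.
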